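(* If $H$ is a hypergraph with maximum vertex degree $\Delta$, then $b_L(H)\le |V(H)|-\left\lceil \frac{|E(H)|}{\Delta}\right\rceil$.
   Context: A hypergraph $H$ consists of a finite vertex set $V(H)$ and a finite collection $E(H)$ of nonempty subsets of $V(H)$. The degree of a vertex is the number of hyperedges containing it. Lazy burning: a set $B\subseteq V(H)$ is burned initially; in each subsequent round every unburned vertex $v$ for which some hyperedge $h\ni v$ has $h\setminus\{v\}$ entirely burned becomes burned. $B$ is a lazy burning set if eventually all vertices burn; $b_L(H)$ is the minimum size of a lazy burning set. *)

(* Defs.v *)
From mathcomp Require Import all_boot all_order all_algebra.

Set Implicit Arguments.
Unset Strict Implicit.
Unset Printing Implicit Defensive.

(* The hyperedges form a collection indexed by a finite type, so that parallel
   hyperedges (distinct indices with the same vertex set) are allowed and are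
   counted with multiplicity in |E(H)| and in degrees; a hypergraph whose
   hyperedges form a set is the case where [hedge] is injective. *)
Record hypergraph := Hypergraph {
  vertex : finType;
  edge : finType;
  hedge : edge -> {set vertex};
  hedge_neq0 : forall e, hedge e != set0
}.

Definition degree (H : hypergraph) (v : vertex H) : nat :=
  #|[set e : edge H | v \in hedge e]|.

(* This is 0 exactly when H has no hyperedges; |E(H)| / max_degree H is then
   0 / 0, which is 0 in rat. *)
Definition max_degree (H : hypergraph) : nat :=
  \max_(v : vertex H) degree v.

Definition burn_step (H : hypergraph) (X : {set vertex H}) : {set vertex H} :=
  X :|: [set v | [exists e : edge H,
                    (v \in hedge e) && (hedge e :\ v \subset X)]].

Definition burned (H : hypergraph) (B : {set vertex H}) (t : nat) :
    {set vertex H} :=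
  iter t (@burn_step H) B.

Definition lazy_burning_set (H : hypergraph) (B : {set vertex H}) : Prop :=
  exists t : nat, burned B t = [set: vertex H].

(* At least one new vertex burns in each round until the process stabilises, so
   |V(H)| rounds decide whether B is a lazy burning set (lazy_burning_setP). *)
Definition lazy_burning_setb (H : hypergraph) (B : {set vertex H}) : bool :=
  burned B #|vertex H| == [set: vertex H].

Lemma lazy_burning_setP (H : hypergraph) (B : {set vertex H}) :
  reflect (lazy_burning_set B) (lazy_burning_setb B).
Proof.
apply: (iffP eqP) => [?|[t Bt]]; first by exists #|vertex H|.
have stab n : burn_step (burned B n) = burned B n \/ n <= #|burned B n|.
  elim: n => [|n [fix_n|le_n]]; first by right.
    by left; rewrite /burned iterS -/(burned B n) !fix_n.
  have [fix_n|neq_n] := eqVneq (burn_step (burned B n)) (burned B n).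
    by left; rewrite /burned iterS -/(burned B n) !fix_n.
  right; apply: leq_ltn_trans le_n _; apply: proper_card.
  by rewrite properEneq eq_sym neq_n subsetUl.
case: (stab #|vertex H|) => [fixV|geV]; last first.
  by apply/eqP; rewrite eqEcard subsetT cardsT.
have le_n m n : burned B m \subset burned B (n + m).
  elim: n => [|n IHn] //; apply: subset_trans IHn _; exact: subsetUl.
have fix_ge n : burned B (n + #|vertex H|) = burned B #|vertex H|.
  by elim: n => [|n IHn] //; rewrite addSn /burned iterS -/(burned B _) IHn.
by apply/eqP; rewrite -subTset -Bt -(fix_ge t) addnC le_n.
Qed.

Lemma lazy_burning_setT (H : hypergraph) : lazy_burning_setb [set: vertex H].
Proof. by apply/lazy_burning_setP; exists 0. Qed.

Definition lazy_burning_number (H : hypergraph) : nat :=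
  #|[arg min_(B < [set: vertex H] | lazy_burning_setb B) #|B|]|.

Lemma lazy_burning_numberP (H : hypergraph) :
  (exists2 B : {set vertex H},
      lazy_burning_set B & #|B| = lazy_burning_number H) /\
  (forall B : {set vertex H},
      lazy_burning_set B -> lazy_burning_number H <= #|B|).
Proof.
rewrite /lazy_burning_number; case: arg_minnP => [|B lazyB minB].
  exact: lazy_burning_setT.
by split=> [|C /lazy_burning_setP /minB //]; exists B => //; apply/lazy_burning_setP.
Qed.

(* Main.v *)
(** Order the vertices arbitrarily and burn initially every vertex that is not
    the last vertex of any hyperedge. The remaining vertices then burn in order,
    since each one is preceded in some hyperedge only by burned vertices. A vertex
    is last in at most Delta hyperedges and every hyperedge has a last vertex, so at
    least |E(H)| / Delta vertices are left out of the initial set. *)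

Require Import Defs.
From mathcomp Require Import all_boot all_order all_algebra.
Import Order.TTheory GRing.Theory Num.Theory.
Local Open Scope ring_scope.

(** The arbitrary vertex order is that of [enum_rank]; a maximum exists because hyperedges are
    nonempty. *)
Lemma edge_last (H : hypergraph) (e : edge H) :
  exists v, (v \in hedge e) &&
    [forall u in hedge e, (enum_rank u <= enum_rank v)%N].
Proof.
have /set0Pn[v0 v0e] := hedge_neq0 e.
case: (@arg_maxnP _ v0 (mem (hedge e)) (fun v => enum_rank v : nat) v0e) => v ve maxv.
by exists v; apply/andP; split=> //; apply/forall_inP.
Qed.

Definition last_vertex (H : hypergraph) (e : edge H) : vertex H :=
  xchoose (edge_last H e).

Lemma last_vertex_in (H : hypergraph) (e : edge H) : last_vertex H e \in hedge e.
Proof. by case/andP: (xchooseP (edge_last H e)). Qed.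

Lemma last_vertex_max (H : hypergraph) (e : edge H) (u : vertex H) :
  u \in hedge e -> (enum_rank u <= enum_rank (last_vertex H e))%N.
Proof. by case/andP: (xchooseP (edge_last H e)) => _ /forall_inP; apply. Qed.

Definition last_vertices (H : hypergraph) : {set vertex H} :=
  [set last_vertex H e | e : edge H].

Lemma lazy_burning_setC_last (H : hypergraph) :
  lazy_burning_set (~: last_vertices H).
Proof.
exists #|vertex H|; apply/setP => v; rewrite inE.
(* Quantitative form for induction on [t]; ranks are below [#|vertex H|], so that many rounds
   suffice. *)
suff burned_lt t (u : vertex H) :
    (enum_rank u < t)%N -> u \in burned (~: last_vertices H) t.
  by apply: burned_lt; exact: ltn_ord.
elim: t u => // t IHt u; rewrite ltnS => le_ut.
have sub_burned n : ~: last_vertices H \subset burned (~: last_vertices H) n.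
  by elim: n => // n IHn; apply: subset_trans IHn _; exact: subsetUl.
have [/imsetP[e _ u_last]|u_init] := boolP (u \in last_vertices H); last first.
  by apply: (subsetP (sub_burned t.+1)); rewrite inE.
(* The other vertices of [e] have rank below that of [u], hence below [t], so [e] burns [u] in round
   [t.+1]. *)
rewrite /burned iterS !inE; apply/orP; right; apply/existsP; exists e.
rewrite {1}u_last last_vertex_in /=; apply/subsetP => w; rewrite !inE.
case/andP => w_neq_u we; apply: IHt; apply: leq_trans le_ut.
rewrite ltn_neqAle [in X in _ && X]u_last last_vertex_max // andbT.
by apply: contraNneq w_neq_u => /val_inj /enum_rank_inj ->.
Qed.

(** Count hyperedges by last vertex: the fibre over [v] consists of hyperedges containing [v]. *)
Lemma card_edge_le (H : hypergraph) :
  (#|edge H| <= #|last_vertices H| * max_degree H)%N.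
Proof.
rewrite -[X in (X <= _)%N]sum1_card.
rewrite (partition_big (last_vertex H) (mem (last_vertices H))) /=;
  last by move=> e _; apply: imset_f.
rewrite -sum_nat_const; apply: leq_sum => v _.
apply: leq_trans (leq_bigmax v); rewrite sum1_card.
by apply: subset_leq_card; apply/subsetP => e /eqP <-; rewrite inE last_vertex_in.
Qed.

Theorem theorem2p15 (H : hypergraph) :
  (lazy_burning_number H)%:Z <=
    #|vertex H|%:Z - Num.ceil (#|edge H|%:Q / (max_degree H)%:Q).
Proof.
have ceil_le :
    Num.ceil (#|edge H|%:Q / (max_degree H)%:Q) <= #|last_vertices H|%:Z.
  (* If the maximum degree is 0, the quotient is 0 by the convention for inverses. *)
  rewrite ceil_le_int; have [->|Delta_gt0] := posnP (max_degree H).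
    by rewrite invr0 mulr0 ler0z.
  rewrite ler_pdivrMr ?ltr0z // -intrM ler_int -PoszM lez_nat.
  exact: card_edge_le.
rewrite lerBrDr; apply: (le_trans (lerD (lexx _) ceil_le)).
rewrite -PoszD lez_nat -(cardsC (last_vertices H)) addnC leq_add2l.
by apply: (lazy_burning_numberP H).2; exact: lazy_burning_setC_last.
Qed.
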